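(* For a matroid $M$, the following statements are equivalent: (1) there are proper flats $F_1$ and $F_2$ of $M$ with $|E(M)-(F_1\cup F_2)|\leq 1$; (2) $\kappa(M^t)<r(M^t)$ for all integers $t\geq 2$; (3) $\kappa(M^t)<r(M^t)$ for some integer $t\geq 2$. Consequently, if $E(M)$ is not the union of two proper flats of $M$ and a singleton subset of $E(M)$, then $\kappa(M^t)=r(M^t)$ for all $t\in\mathbb{N}$.
   Context: A cyclic flat of a matroid $M$ is a flat $F$ such that $M|F$ has no coloops; $\mathcal{Z}(M)$ denotes the set of cyclic flats, and a matroid is determined by its cyclic flats and their ranks. The $t$-expansion: fix $t\in\mathbb{N}$; for each $e\in E(M)$ let $S_e$ be a $t$-element set with $e\in S_e$, the sets $S_e$ pairwise disjoint; for $X\subseteq E(M)$ let $S_X=\bigcup_{e\in X}S_e$. The $t$-expansion $M^t$ is the matroid on $S_{E(M)}$ whose cyclic flats are exactly the sets $S_A$ with $A\in\mathcal{Z}(M)$, with $r_{M^t}(S_A)=t\cdot r_M(A)$. For $X\subseteq E(M)$ let $\overline{X}=E(M)-X$ and $\lambda_M(X)=r(X)+r(\overline{X})-r(M)$. A vertical $k$-separation is a pair $(X,\overline{X})$ with $r(X)\geq k$, $r(\overline{X})\geq k$ and $\lambda_M(X)<k$. The vertical connectivity $\kappa(M)$ is the least $k$ such that $M$ has a vertical $k$-separation if one exists, and $\kappa(M)=r(M)$ otherwise; in particular $\kappa(M)<r(M)$ if and only if $E(M)$ is a union of two proper flats of $M$. *)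

(* Defs.v *)
From mathcomp Require Import all_boot.
From mathcomp Require Import zify.
Set Implicit Arguments.
Unset Strict Implicit.
Unset Printing Implicit Defensive.

(* A matroid whose ground set E(M) is the whole finite type [T], given by its
   rank function. *)
Record matroid (T : finType) := Matroid {
  rk : {set T} -> nat;
  rk_card : forall X, rk X <= #|X|;
  rk_mono : forall X Y : {set T}, X \subset Y -> rk X <= rk Y;
  rk_submod : forall X Y, rk (X :|: Y) + rk (X :&: Y) <= rk X + rk Y }.

Section Notions.
Variable T : finType.
Implicit Types (M : matroid T) (X F : {set T}).

Definition rank M := rk M setT.
Definition indep M X := rk M X == #|X|.
Definition basis M X := maxset (indep M) X.
Definition coloop M e := [forall B, basis M B ==> (e \in B)].
Definition cl M X := [set x | rk M (x |: X) == rk M X].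
Definition flat M F := cl M F == F.
Definition proper_flat M F := flat M F && (F != setT).

End Notions.

Section Restriction.
Variables (T : finType) (M : matroid T) (A : {set T}).
Local Notation U := {x : T | x \in A}.
Local Definition res_rk (X : {set U}) := rk M (val @: X).

Local Lemma res_card (X : {set U}) : res_rk X <= #|X|.
Proof. by rewrite (leq_trans (rk_card M _)) // leq_imset_card. Qed.

Local Lemma res_mono (X Y : {set U}) : X \subset Y -> res_rk X <= res_rk Y.
Proof. by move=> sXY; apply/rk_mono/imsetS. Qed.

Local Lemma res_submod (X Y : {set U}) :
  res_rk (X :|: Y) + res_rk (X :&: Y) <= res_rk X + res_rk Y.
Proof.
rewrite /res_rk imsetU imsetI ?rk_submod // => x y _ _; exact: val_inj.
Qed.

Definition restrict : matroid {x : T | x \in A} :=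
  Matroid res_card res_mono res_submod.
End Restriction.

Section Connectivity.
Variable T : finType.
Implicit Types (M : matroid T) (X F : {set T}).

Definition cyclic_flat M F :=
  flat M F && [forall e, ~~ coloop (restrict M F) e].

(* The subtraction does not truncate, by submodularity. *)
Definition conn M X := rk M X + rk M (~: X) - rank M.

Definition vertical_separation M k X :=
  [&& k <= rk M X, k <= rk M (~: X) & conn M X < k].

(* A vertical k-separation forces k <= rank M, so a search over
   'I_(rank M).+1 is exhaustive; see [kappa_min] and [kappa_none]. *)
Definition kappa M : nat :=
  let sep k := [exists X, vertical_separation M k X] in
  if [pick k : 'I_(rank M).+1 |
        sep k && [forall j : 'I_(rank M).+1, sep j ==> (k <= j)]] is Some k
  then k else rank M.

Lemma kappa_min M k X : vertical_separation M k X ->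
  (exists Y, vertical_separation M (kappa M) Y) /\ kappa M <= k.
Proof.
move=> sepX.
have lek j Y : vertical_separation M j Y -> j < (rank M).+1.
  by case/and3P=> le1 _ _; rewrite ltnS (leq_trans le1) // rk_mono ?subsetT.
rewrite /kappa; case: pickP => [j /andP[/existsP[Y sepY] /forallP min]|none].
  split; first by exists Y.
  by have /implyP := min (Ordinal (lek _ _ sepX)); apply; apply/existsP; exists X.
pose P (j : 'I_(rank M).+1) := [exists X, vertical_separation M j X].
have P0 : P (Ordinal (lek _ _ sepX)) by apply/existsP; exists X.
case: (arg_minnP (fun j : 'I__ => nat_of_ord j) P0) => j Pj min.
have /negP[] := negbT (none j); rewrite -[X in X && _]/(P j) Pj.
by apply/forallP=> i; apply/implyP; apply: min.
Qed.

Lemma kappa_none M :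
  (forall k X, ~~ vertical_separation M k X) -> kappa M = rank M.
Proof.
move=> none; rewrite /kappa; case: pickP => // k /andP[/existsP[X sepX]].
by have := none k X; rewrite sepX.
Qed.

End Connectivity.

Section Expansion.
Variables (T : finType) (t : nat).
Implicit Types (X : {set T}).

(* The elements of the expansion are pairs; e is identified with (e, 0). *)
Definition blk (e : T) : {set T * 'I_t} := [set p | p.1 == e].
Definition blow X : {set T * 'I_t} := \bigcup_(e in X) blk e.

Definition is_expansion (M : matroid T) (N : matroid (T * 'I_t)%type) :=
  (forall C, cyclic_flat N C <-> exists2 A, cyclic_flat M A & C = blow A) /\
  (forall A, cyclic_flat M A -> rk N (blow A) = t * rk M A).

Lemma card_blk e : #|blk e| = t.
Proof.
rewrite -[RHS]card_ord -(card_imset predT (f := fun i : 'I_t => (e, i))).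
  apply: eq_card => -[x i]; rewrite !inE /=; apply/eqP/imsetP => [->|].
    by exists i.
  by case=> j _ [].
by move=> i j [].
Qed.

Lemma in_blow X p : (p \in blow X) = (p.1 \in X).
Proof.
apply/bigcupP/idP => [[e eX]|pX]; first by rewrite inE => /eqP->.
by exists p.1; rewrite // inE.
Qed.

Lemma card_blow X : #|blow X| = t * #|X|.
Proof.
rewrite mulnC; have -> : blow X = setX X setT.
  by apply/setP=> -[x i]; rewrite in_blow !inE andbT.
by rewrite cardsX cardsT card_ord.
Qed.

End Expansion.

Section RankTheory.
Variables (T : finType) (M : matroid T).
Implicit Types X Y A B I J F : {set T}.
Local Notation r := (rk M).

Lemma rk_setU X Y : r (X :|: Y) <= r X + #|Y|.
Proof.
by have := rk_submod M X Y; have := rk_card M Y; lia.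
Qed.

Lemma rk_diff X Y : r X <= r Y + #|X :\: Y|.
Proof.
apply: leq_trans (rk_setU _ _); apply: rk_mono.
by apply/subsetP=> x xX; rewrite !inE xX andbT orbN.
Qed.

Lemma rkU1 x X : r (x |: X) <= (r X).+1.
Proof. by rewrite setUC (leq_trans (rk_setU _ _)) // cards1 addn1. Qed.

Lemma rk_closed X Y : X \subset Y ->
  (forall x, x \in Y -> r (x |: X) = r X) -> r Y = r X.
Proof.
move=> sXY clX; case: (arg_maxnP (fun Z : {set T} => #|Z|)
  (P := fun Z => [&& X \subset Z, Z \subset Y & r Z == r X]) (i0 := X)).
  by rewrite subxx sXY eqxx.
move=> Z /and3P[sXZ sZY /eqP rZ] max.
have [sYZ|] := boolP (Y \subset Z).
  by rewrite -rZ; congr rk; apply/eqP; rewrite eqEsubset sYZ.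
case/subsetPn=> x xY xZ.
suff : #|x |: Z| <= #|Z| by rewrite cardsU1 xZ ltnn.
apply: max; rewrite (subset_trans sXZ) ?subsetU1 // subUset sub1set xY sZY /=.
have := rk_submod M (x |: X) Z; rewrite clX // rZ.
have -> : (x |: X) :|: Z = x |: Z by rewrite -setUA (setUidPr sXZ).
have : r X <= r ((x |: X) :&: Z).
  by apply: rk_mono; rewrite subsetI subsetU1.
have : r Z <= r (x |: Z) by apply: rk_mono; rewrite subsetU1.
rewrite rZ; lia.
Qed.

Lemma indep_ext I X : I \subset X -> indep M I ->
  exists J, [/\ I \subset J, J \subset X, indep M J & #|J| = r X].
Proof.
move=> sIX iI; case: (arg_maxnP (fun Z : {set T} => #|Z|)
  (P := fun Z => [&& I \subset Z, Z \subset X & indep M Z]) (i0 := I)).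
  by rewrite subxx sIX.
move=> J /and3P[sIJ sJX iJ] max; exists J; split=> //.
rewrite -(eqP iJ); apply/esym/rk_closed => // x xX.
have [xJ|xJ] := boolP (x \in J); first by rewrite (setUidPr _) ?sub1set.
have lo : r J <= r (x |: J) by apply: rk_mono; rewrite subsetU1.
have hi := rkU1 x J; apply/eqP; rewrite eqn_leq lo andbT leqNgt.
apply/negP => lt; have : #|x |: J| <= #|J|.
  apply: max; rewrite (subset_trans sIJ) ?subsetU1 // subUset sub1set xX sJX /=.
  by rewrite /indep cardsU1 xJ -(eqP iJ); lia.
by rewrite cardsU1 xJ ltnn.
Qed.

Lemma indep0 : indep M set0.
Proof. by rewrite /indep; have := rk_card M set0; rewrite cards0; lia. Qed.

Lemma basis_card B : basis M B -> indep M B /\ #|B| = rank M.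
Proof.
case/maxsetP=> iB max; split=> //.
have [J [sBJ _ iJ cJ]] := indep_ext (subsetT B) iB.
by rewrite /rank -cJ (max J).
Qed.

Lemma card_basis B : indep M B -> #|B| = rank M -> basis M B.
Proof.
move=> iB cB; apply/maxsetP; split=> // J iJ sBJ; apply/esym/eqP.
by rewrite eqEcard sBJ cB -(eqP iJ) rk_mono ?subsetT.
Qed.

Lemma coloopE e : coloop M e = (rk M (~: [set e]) < rank M).
Proof.
apply/forallP/idP => [col|lt B].
  rewrite ltnNge; apply/negP => le.
  have [J [_ sJ iJ cJ]] := indep_ext (sub0set (~: [set e])) indep0.
  have bJ : basis M J.
    apply: card_basis => //; rewrite cJ; apply/eqP.
    by rewrite eqn_leq le rk_mono ?subsetT.
  have /implyP/(_ bJ) eJ := col J.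
  by have := subsetP sJ e eJ; rewrite !inE eqxx.
apply/implyP => /basis_card[iB cB]; apply/negPn/negP => eB.
have : r B <= r (~: [set e]).
  by apply: rk_mono; apply/subsetP=> x xB; rewrite !inE; apply: contraNneq eB => <-.
by rewrite (eqP iB) cB leqNgt lt.
Qed.

Lemma flatP F :
  reflect (forall x, x \notin F -> r F < r (x |: F)) (flat M F).
Proof.
have lo x : r F <= r (x |: F) by apply: rk_mono; rewrite subsetU1.
apply: (iffP eqP) => [clF x|lt].
  by rewrite -{1}clF inE ltn_neqAle lo andbT eq_sym.
apply/setP=> x; rewrite inE; have [xF|xF] := boolP (x \in F).
  by rewrite (setUidPr _) ?sub1set ?eqxx.
by have := lt x xF; lia.
Qed.

End RankTheory.

Lemma cyclic_flatP (T : finType) (M : matroid T) (F : {set T}) :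
  reflect ((forall x, x \notin F -> rk M F < rk M (x |: F)) /\
           (forall x, x \in F -> rk M (F :\ x) = rk M F)) (cyclic_flat M F).
Proof.
have E (x : {x | x \in F}) :
    coloop (restrict M F) x = (rk M (F :\ val x) < rk M F).
  rewrite coloopE /rank /=; congr (rk M _ < rk M _); apply/setP=> y.
    apply/imsetP/idP => [[z]|].
      by rewrite !inE => zx ->; rewrite (valP z) andbT.
    rewrite !inE => /andP[yx yF]; exists (Sub y yF); rewrite // !inE.
    by apply: contraNneq yx => <-.
  apply/imsetP/idP => [[z _ ->]|yF]; first exact: valP.
  by exists (Sub y yF).
have lo x : rk M (F :\ x) <= rk M F by apply: rk_mono; rewrite subD1set.
apply: (iffP andP) => [[/flatP fl /forallP cyc]|[fl cyc]]; split=> //.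
- move=> x xF; have := cyc (Sub x xF); rewrite E /=; have := lo x; lia.
- exact/flatP.
- by apply/forallP=> x; rewrite E cyc ?ltnn // (valP x).
Qed.

Section Determined.
Variables (T : finType).
Implicit Types M N : matroid T.

Lemma cyclic_flat_attain M X :
  exists2 A, cyclic_flat M A & rk M A + #|X :\: A| = rk M X.
Proof.
pose P B := rk M B + #|X :\: B| == rk M X.
pose w (B : {set T}) := rk M B * #|T|.+1 + (#|T| - #|B|).
have PX : P X by rewrite /P setDv cards0 addn0.
have [A /eqP PA min] := arg_minnP w PX; exists A => //.
have cT (B : {set T}) : #|B| <= #|T| by apply: max_card.
apply/cyclic_flatP; split=> x xA.
  rewrite ltnNge; apply/negP => le.
  have rE : rk M (x |: A) = rk M A.
    by apply/eqP; rewrite eqn_leq le rk_mono ?subsetU1.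
  have /min : P (x |: A).
    rewrite /P rE; have := rk_diff M X (x |: A); rewrite rE.
    have : #|X :\: (x |: A)| <= #|X :\: A|.
      by rewrite subset_leq_card // setDS ?subsetU1.
    by lia.
  by rewrite /w rE; have := cT (x |: A); rewrite cardsU1 xA; lia.
apply/eqP; rewrite eqn_leq rk_mono ?subD1set //= leqNgt; apply/negP => lt.
have /min : P (A :\ x).
  rewrite /P; have := rk_diff M X (A :\ x).
  have : #|X :\: (A :\ x)| <= #|X :\: A| + 1.
    rewrite -(cards1 x); apply: leq_trans (leq_card_setU _ _).
    apply/subset_leq_card/subsetP=> y; rewrite !inE.
    by case: (y == x); rewrite ?orbT ?orbF.
  by lia.
rewrite /w; have := cT A; have := cT (A :\ x); nia.
Qed.

Lemma cyclic_flats_determine M N :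
  cyclic_flat M =1 cyclic_flat N ->
  (forall A, cyclic_flat M A -> rk M A = rk N A) -> rk M =1 rk N.
Proof.
have le M' N' : cyclic_flat M' =1 cyclic_flat N' ->
    (forall A, cyclic_flat M' A -> rk M' A = rk N' A) ->
    forall X, rk M' X <= rk N' X.
  move=> eqZ eqr X; have [A ZA <-] := cyclic_flat_attain N' X.
  by rewrite -eqr ?eqZ // rk_diff.
move=> eqZ eqr X; apply/eqP; rewrite eqn_leq !le //.
by move=> A; rewrite -eqZ => /eqr.
Qed.

End Determined.

Lemma is_expansion_unique (T : finType) (t : nat) (M : matroid T)
    (N N' : matroid (T * 'I_t)%type) :
  is_expansion M N -> is_expansion M N' -> rk N =1 rk N'.
Proof.
move=> [ZN rN] [ZN' rN']; apply: cyclic_flats_determine => [C|C].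
  by apply/idP/idP => [/ZN/ZN'|/ZN'/ZN].
by case/ZN=> A ZA ->; rewrite rN ?rN'.
Qed.

Section ExpansionExists.
Variables (T : finType) (t : nat) (M : matroid T).
Local Notation U := (T * 'I_t)%type.
Local Notation r := (rk M).
Implicit Types (X Y C : {set U}) (A B : {set T}).

Local Definition pr X : {set T} := fst @: X.
Local Definition f X Y := t * r (pr Y) + #|X :\: Y|.
Local Definition opt X : {set U} := [arg min_(Y < set0 | Y \subset X) f X Y].
Local Definition r' X := f X (opt X).

Local Lemma optP X : opt X \subset X /\ forall Y, Y \subset X -> r' X <= f X Y.
Proof. by rewrite /r' /opt; case: arg_minnP; rewrite ?sub0set. Qed.

Local Lemma r'_card X : r' X <= #|X|.
Proof.
have [_ /(_ set0 (sub0set _))] := optP X.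
have := rk_card M (pr set0); rewrite /f /pr imset0 cards0 setD0; nia.
Qed.

Local Lemma r'_mono X Y : X \subset Y -> r' X <= r' Y.
Proof.
move=> sXY; have [_ min] := optP X; have [sY _] := optP Y.
apply: leq_trans (min (opt Y :&: X) (subsetIr _ _)) _; apply: leq_add.
  by rewrite leq_mul2l rk_mono ?orbT // imsetS ?subsetIl.
apply/subset_leq_card/subsetP=> p; rewrite !inE.
by move=> /andP[h pX]; move: h; rewrite pX andbT (subsetP sXY) // andbT.
Qed.

Local Lemma r'_submod X Y : r' (X :|: Y) + r' (X :&: Y) <= r' X + r' Y.
Proof.
have [sX _] := optP X; have [sY _] := optP Y.
have [_ minU] := optP (X :|: Y); have [_ minI] := optP (X :&: Y).
have := minU _ (setUSS sX sY); have := minI _ (setISS sX sY).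
rewrite /r' /f; set P := opt X in sX *; set Q := opt Y in sY *.
have cD (A B : {set U}) : A \subset B -> #|B :\: A| + #|A| = #|B|.
  by move=> sAB; rewrite -(cardsID A B) (setIidPr sAB) addnC.
have := cD _ _ sX; have := cD _ _ sY.
have := cD _ _ (setUSS sX sY); have := cD _ _ (setISS sX sY).
have := cardsUI X Y; have := cardsUI P Q.
have : t * r (pr (P :|: Q)) + t * r (pr (P :&: Q)) <= t * r (pr P) + t * r (pr Q).
  rewrite -!mulnDr leq_mul2l; apply/orP; right.
  apply: leq_trans (rk_submod M _ _); rewrite /pr imsetU leq_add2l.
  by rewrite rk_mono ?imsetI_sub // subsetI !imsetS ?subsetIl ?subsetIr.
lia.
Qed.

Local Definition N : matroid U := Matroid r'_card r'_mono r'_submod.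

Local Lemma pr_blow A : 0 < t -> pr (blow t A) = A.
Proof.
move=> t0; apply/setP=> x; apply/imsetP/idP => [[p]|xA].
  by rewrite in_blow => pA ->.
by exists (x, Ordinal t0); rewrite ?in_blow.
Qed.

Local Lemma f_blow A : r' (blow t A) <= t * r A.
Proof.
have [_ /(_ _ (subxx _)) h] := optP (blow t A); apply: leq_trans h _.
rewrite /f setDv cards0 addn0 leq_mul2l rk_mono ?orbT //.
by apply/subsetP=> x /imsetP[p]; rewrite in_blow => ? ->.
Qed.

Local Lemma blowD A Y : t * #|A :\: pr Y| <= #|blow t A :\: Y|.
Proof.
rewrite -card_blow; apply/subset_leq_card/subsetP=> p.
rewrite !inE !in_blow !inE => /andP[pY ->]; rewrite andbT.
by apply: contra pY => pY; apply/imsetP; exists p.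
Qed.

Local Lemma r'_blow A : r' (blow t A) = t * r A.
Proof.
apply/eqP; rewrite eqn_leq f_blow //= /r' /f.
have := blowD A (opt (blow t A)); have := rk_diff M A (pr (opt (blow t A))).
by nia.
Qed.

Local Lemma sub_blow C : C \subset blow t (pr C).
Proof. by apply/subsetP=> p pC; rewrite in_blow; apply/imsetP; exists p. Qed.

Local Lemma cyc_blow A : cyclic_flat M A -> cyclic_flat N (blow t A).
Proof.
case/cyclic_flatP=> fl cyc; apply/cyclic_flatP; split=> p; rewrite in_blow.
  move=> pA; rewrite /= r'_blow /r'; set X := p |: _.
  have [+ _] := optP X; move: (opt X) => Y sY; rewrite /f.
  have t0 : 0 < t by apply: leq_trans (ltn_ord p.2).
  have dYA := blowD A Y; have rA := rk_diff M A (pr Y).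
  have [pY|pY] := boolP (p \in Y).
    have : #|blow t A :\: Y| <= #|X :\: Y|.
      by rewrite subset_leq_card // setSD // subsetU1.
    have : r (p.1 |: A) <= r (pr Y) + #|A :\: pr Y|.
      apply: leq_trans (rk_diff _ _ (pr Y)) _.
      rewrite leq_add2l; apply/subset_leq_card/subsetP=> x; rewrite !inE.
      case/andP=> xY; rewrite xY /= => /orP[/eqP xp|//].
      by rewrite xp in xY; case/negP: xY; apply/imsetP; exists p.
    by have := fl _ pA; nia.
  have -> : X :\: Y = p |: (blow t A :\: Y).
    by apply/setP=> q; rewrite !inE; case: eqP => // ->; rewrite pY.
  have : t * r A <= t * (r (pr Y) + #|A :\: pr Y|) by rewrite leq_mul2l rA orbT.
  by rewrite cardsU1 !inE in_blow (negbTE pA) andbF addnCA ltnS mulnDr => h;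
    rewrite (leq_trans h) // leq_add2l.
move=> pA; apply/eqP; rewrite eqn_leq r'_mono ?subD1set //= r'_blow /r'.
set X := blow t A :\ p; have [+ _] := optP X; move: (opt X) => Y sY; rewrite /f.
have t0 : 0 < t by apply: leq_trans (ltn_ord p.2).
have pY : p \notin Y by apply/negP => /(subsetP sY); rewrite !inE eqxx.
have e1 : #|blow t A :\: Y| = #|X :\: Y|.+1.
  rewrite (cardsD1 p) !inE pY in_blow pA /= add1n; congr _.+1.
  by apply: eq_card => q; rewrite !inE; case: (q == p); rewrite ?andbF.
have [eY|eY] := boolP (p.1 \in pr Y).
  have : t * #|A :\: pr Y| <= #|X :\: Y|.
    rewrite -card_blow; apply/subset_leq_card/subsetP=> q.
    rewrite in_blow !inE in_blow => /andP[qY ->]; rewrite andbT.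
    apply/andP; split; last by apply: contraNneq qY => ->.
    by apply: contra qY => qY; apply/imsetP; exists q.
  by have := rk_diff M A (pr Y); nia.
have := rk_diff M (A :\ p.1) (pr Y); rewrite cyc //.
have : #|A :\: pr Y| = #|(A :\ p.1) :\: pr Y|.+1.
  rewrite (cardsD1 p.1) !inE eY pA /= add1n; congr _.+1.
  by apply: eq_card => q; rewrite !inE; case: (q == p.1); rewrite ?andbF.
by have := blowD A Y; nia.
Qed.

Local Lemma cyc_inv C : cyclic_flat N C -> exists2 A, cyclic_flat M A & C = blow t A.
Proof.
have [t0|t0] := posnP t.
  have [A ZA _] := cyclic_flat_attain M set0; exists A => //.
  by apply/setP=> -[x i]; have := ltn_ord i; rewrite {2}t0.
case/cyclic_flatP=> /= fl cyc; have [sYC _] := optP C.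
have eC : opt C = C.
  apply/eqP; rewrite eqEsubset sYC; apply/subsetP=> p pC; apply/negPn/negP=> pY.
  have [_ min] := optP (C :\ p).
  have /min : opt C \subset C :\ p by rewrite subsetD1 sYC.
  rewrite cyc // /r' /f; rewrite [X in _ + X <= _](cardsD1 p) !inE pY pC /=.
  have -> : (C :\: opt C) :\ p = (C :\ p) :\: opt C.
    by apply/setP=> q; rewrite !inE; case: (q == p); rewrite ?andbF.
  by lia.
have rC : r' C = t * r (pr C) by rewrite /r' /f eC setDv cards0 addn0.
have CE : C = blow t (pr C).
  apply/eqP; rewrite eqEsubset sub_blow; apply/subsetP=> p pB.
  apply/negPn/negP => /fl; rewrite rC ltnNge => /negP[].
  by rewrite -r'_blow r'_mono // subUset sub1set pB sub_blow.
exists (pr C) => //; set B := pr C in rC CE *; rewrite {}CE in fl cyc rC *.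
apply/cyclic_flatP; split=> x xB.
  have := fl (x, Ordinal t0); rewrite in_blow => /(_ xB).
  rewrite r'_blow => lt; rewrite -(ltn_pmul2l t0) (leq_trans lt) //.
  rewrite -r'_blow; apply: r'_mono; apply/subsetP=> q.
  by rewrite !inE !in_blow !inE => /orP[/eqP->|->]; rewrite ?eqxx ?orbT.
have := cyc (x, Ordinal t0); rewrite in_blow => /(_ xB); rewrite r'_blow => e.
apply/eqP; rewrite eqn_leq rk_mono ?subD1set //= leqNgt; apply/negP => lt.
have [_ /(_ (blow t (B :\ x)))] := optP (blow t B :\ (x, Ordinal t0)).
rewrite e /f pr_blow // => h; have := h _.
have -> : blow t (B :\ x) \subset blow t B :\ (x, Ordinal t0).
  apply/subsetP=> q; rewrite !inE !in_blow !inE => /andP[qx ->]; rewrite andbT.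
  by apply: contraNneq qx => ->.
move=> /(_ isT); rewrite leqNgt => /negP[].
have : #|(blow t B :\ (x, Ordinal t0)) :\: blow t (B :\ x)| < t.
  rewrite -[X in _ < X](card_blk t x) (cardsD1 (x, Ordinal t0) (blk t x)).
  rewrite inE eqxx add1n ltnS; apply/subset_leq_card/subsetP=> q.
  rewrite !inE !in_blow !inE => /and3P[h1 -> h2]; move: h1.
  by rewrite h2 andbT negbK => ->.
by nia.
Qed.

(* The rank function min_(Y \subset X) (t * r(pr Y) + |X - Y|) works. *)
Lemma expansion_exists :
  {N0 : matroid (T * 'I_t)%type | is_expansion M N0}.
Proof.
exists N; split=> [C|A _]; last exact: r'_blow.
by split=> [/cyc_inv|[A ZA ->]] //; apply: cyc_blow.
Qed.

End ExpansionExists.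

(* The t-expansion; it is unique by [is_expansion_unique]. *)
Definition expansion (T : finType) (t : nat) (M : matroid T) :
  matroid (T * 'I_t)%type := sval (expansion_exists t M).

Lemma expansionP (T : finType) (t : nat) (M : matroid T) :
  is_expansion M (expansion t M).
Proof. exact: svalP. Qed.

(* Main.v *)
Require Import Defs.
From mathcomp Require Import all_boot.
From mathcomp Require Import zify.

(** The inequality [kappa M < rank M] says that the ground set splits into two
non-spanning parts. If [F1] and [F2] are proper flats that miss only [e], then
for [t >= 2] the set [S_{F1}] with one element of [S_e], and [S_{F2}] with the
other [t - 1], have rank at most [t * (r - 1) + (t - 1) < t * r]. Conversely, if
[X] and its complement are non-spanning in the expansion, then there are cyclic
flats [A], [B] of [M] with [t * r A + |X - S_A| < t * r] and
[t * r B + |~X - S_B| < t * r]. Adding these, the set [W] of elements outside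
[A] and [B] has fewer than [(r - r A) + (r - r B)] elements, so adding
[r - r A - 1] elements of [W] to [A] and [r - r B - 1] others to [B] gives two
non-spanning sets that miss at most one element. *)

Section NonSpanning.
Context {T : finType}.
Implicit Types (M : matroid T) (X F : {set T}).

(** In a vertical k-separation, [conn M X < k <= rk M X] forces [~: X] to be non-spanning, and
    symmetrically [X]. *)
Lemma kappa_eq_rank M :
  (forall X, ~ (rk M X < rank M /\ rk M (~: X) < rank M)) -> kappa M = rank M.
Proof.
move=> none; apply: kappa_none => k X; apply/negP => /and3P[h1 h2].
by rewrite /conn => h3; apply: (none X); lia.
Qed.

Lemma kappa_ltP M : kappa M < rank M <->
  exists X, rk M X < rank M /\ rk M (~: X) < rank M.
Proof.
split=> [lt|[X [ltX ltC]]].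
  case: (pickP (fun X => (rk M X < rank M) && (rk M (~: X) < rank M)))
    => [X /andP[h1 h2]|none]; first by exists X.
  suff e : kappa M = rank M by rewrite e ltnn in lt.
  by apply: kappa_eq_rank => X [h1 h2]; have /= := none X; rewrite h1 h2.
(* Since [~: X] is non-spanning, [conn M X < rk M X], and likewise for the other side; so this order
   is admissible. *)
have sep : vertical_separation M (conn M X).+1 X.
  have := rk_submod M X (~: X); rewrite setUCr.
  by rewrite /vertical_separation /conn -/(rank M); lia.
have [_ le] := kappa_min sep.
by apply: leq_ltn_trans le _; case/and3P: sep => le _ _; apply: leq_ltn_trans ltX.
Qed.

Lemma proper_flat_rk M F : proper_flat M F -> rk M F < rank M.
Proof.
case/andP=> /flatP fl; rewrite -subTset => /subsetPn[x _ /fl lt].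
by apply: leq_trans lt _; rewrite rk_mono ?subsetT.
Qed.

(** A maximal non-spanning set is a flat: one more element makes it spanning. *)
Lemma sub_proper_flat M X : rk M X < rank M ->
  exists2 F, proper_flat M F & X \subset F.
Proof.
move=> ltX; have [F /maxsetP[ltF max] sXF] :=
  maxset_exists (P := fun Z => rk M Z < rank M) ltX.
exists F => //; apply/andP; split.
  apply/flatP => x xF; apply: leq_trans ltF _; rewrite leqNgt.
  apply/negP => /max/(_ (subsetU1 _ _)) e.
  by rewrite -e setU11 in xF.
by apply/eqP => e; rewrite e ltnn in ltF.
Qed.

End NonSpanning.

Lemma subset_of_card (T : finType) (A : {set T}) (k : nat) :
  exists2 B : {set T}, B \subset A & #|B| = minn k #|A|.
Proof.
exists [set x in take k (enum A)].
  by apply/subsetP => x; rewrite inE => /mem_take; rewrite mem_enum.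
rewrite cardsE (card_uniqP _) ?take_uniq ?enum_uniq // size_take_min.
by rewrite -cardE.
Qed.

Lemma card_setC_le1 (T : finType) (A B : {set T}) (a b : nat) :
  #|~: (A :|: B)| <= (a + b).+1 ->
  exists A' B' : {set T}, [/\ #|A'| <= a, #|B'| <= b
    & #|~: ((A :|: A') :|: (B :|: B'))| <= 1].
Proof.
set W := ~: (A :|: B) => leW.
have [A' sA' cA'] := subset_of_card _ W a.
have [B' sB' cB'] := subset_of_card _ (W :\: A') b.
have cD (P Q : {set T}) : P \subset Q -> #|Q :\: P| + #|P| = #|Q|.
  by move=> sPQ; rewrite -(cardsID P Q) (setIidPr sPQ) addnC.
have eC : ~: ((A :|: A') :|: (B :|: B')) = (W :\: A') :\: B'.
  apply/setP => x; rewrite !inE.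
  by do ![case: (x \in _)].
exists A', B'; rewrite eC; have := cD _ _ sA'; have := cD _ _ sB'.
by split; lia.
Qed.

Section ExpansionRank.
Context {T : finType} (t : nat) (M : matroid T).
Local Notation N := (expansion t M).
Implicit Types (A B F : {set T}) (X : {set (T * 'I_t)%type}).

Lemma blow_setD A B : blow t A :\: blow t B = blow t (A :\: B).
Proof. by apply/setP => p; rewrite !inE !in_blow !inE. Qed.

Lemma blow_setT : blow t [set: T] = setT.
Proof. by apply/setP => p; rewrite in_blow !inE. Qed.

Lemma rk_expansion_attain X :
  exists A, t * rk M A + #|X :\: blow t A| = rk N X.
Proof.
have [Z r] := expansionP t M; have [C ZC <-] := cyclic_flat_attain N X.
by have /Z[A ZA ->] := ZC; exists A; rewrite r.
Qed.

(** The definition gives this for cyclic flats only. For other [A], each inequality takes a set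
    attaining the rank on one side and applies [rk_diff] on the other. *)
Lemma rk_expansion_blow A : rk N (blow t A) = t * rk M A.
Proof.
apply/eqP; rewrite eqn_leq; apply/andP; split.
  have [Z r] := expansionP t M; have [B ZB <-] := cyclic_flat_attain M A.
  by rewrite mulnDr -r // -card_blow -blow_setD rk_diff.
have [B <-] := rk_expansion_attain (blow t A).
by rewrite blow_setD card_blow -mulnDr leq_mul2l rk_diff orbT.
Qed.

Lemma rank_expansion : rank N = t * rank M.
Proof. by rewrite /rank -blow_setT rk_expansion_blow. Qed.

Lemma nonspanning_expansion_inv X :
  rk N X < rank N -> rk N (~: X) < rank N ->
  exists F1 F2 : {set T},
    [/\ proper_flat M F1, proper_flat M F2 & #|~: (F1 :|: F2)| <= 1].
Proof.
rewrite rank_expansion.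
have [A <-] := rk_expansion_attain X.
have [B <-] := rk_expansion_attain (~: X) => ltA ltB.
(* Each of the [t] copies of an element outside [A] and [B] lies in [X] or in [~: X]. *)
have leW : t * #|~: (A :|: B)| <= #|X :\: blow t A| + #|~: X :\: blow t B|.
  rewrite -card_blow; apply: leq_trans (leq_card_setU _ _).
  apply/subset_leq_card/subsetP => p; rewrite !inE !in_blow !inE negb_or.
  by case/andP=> -> -> /=; rewrite orbN.
have rA : rk M A < rank M by nia.
have rB : rk M B < rank M by nia.
have le : #|~: (A :|: B)| <=
    ((rank M - rk M A).-1 + (rank M - rk M B).-1).+1 by nia.
have [A' [B' [cA cB cW]]] := card_setC_le1 _ _ _ _ _ le.
have [F1 pF1 sF1] : exists2 F, proper_flat M F & A :|: A' \subset F.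
  by apply: sub_proper_flat; have := rk_setU M A A'; lia.
have [F2 pF2 sF2] : exists2 F, proper_flat M F & B :|: B' \subset F.
  by apply: sub_proper_flat; have := rk_setU M B B'; lia.
exists F1, F2; split=> //; apply: leq_trans cW.
by rewrite subset_leq_card // setCS setUSS.
Qed.

Lemma nonspanning_expansion F1 F2 : 1 < t ->
  proper_flat M F1 -> proper_flat M F2 -> #|~: (F1 :|: F2)| <= 1 ->
  exists X, rk N X < rank N /\ rk N (~: X) < rank N.
Proof.
move=> t2 /proper_flat_rk r1 /proper_flat_rk r2 leW; rewrite rank_expansion.
have t0 : 0 < t by lia.
(* [W] may be empty; taking one copy of each of its elements treats both cases at once. *)
set W := ~: (F1 :|: F2) in leW; pose Y := [set (x, Ordinal t0) | x in W].
have cY : #|Y| = #|W| by apply: card_imset => x y [].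
have sY : Y \subset blow t W.
  by apply/subsetP => _ /imsetP[x xW ->]; rewrite in_blow.
have cWY : #|blow t W :\: Y| + #|Y| = t * #|W|.
  by rewrite -card_blow -(cardsID Y (blow t W)) (setIidPr sY) addnC.
have ltWY : #|blow t W :\: Y| < t.
  by move: cWY leW; rewrite cY; case: #|W| => [|[|n]] //; lia.
have scale F : rk M F < rank M -> t * rk M F + t <= t * rank M.
  by move=> ltF; rewrite addnC -mulnS leq_mul2l ltF orbT.
have s1 := scale _ r1; have s2 := scale _ r2.
exists (blow t F1 :|: Y); split.
  by have := rk_setU N (blow t F1) Y; rewrite rk_expansion_blow cY; lia.
have : rk N (~: (blow t F1 :|: Y)) <= rk N (blow t F2 :|: (blow t W :\: Y)).
  apply: rk_mono; apply/subsetP => p; rewrite !inE !in_blow !inE.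
  by do ![case: (_ \in _)].
by have := rk_setU N (blow t F2) (blow t W :\: Y);
  rewrite rk_expansion_blow; lia.
Qed.

End ExpansionRank.

Theorem theorem5p3 (T : finType) (M : matroid T) :
  ((exists F1 F2 : {set T},
      [/\ proper_flat M F1, proper_flat M F2 & #|~: (F1 :|: F2)| <= 1])
   <-> (forall t : nat, 2 <= t -> kappa (expansion t M) < rank (expansion t M)))
  /\ ((forall t : nat, 2 <= t -> kappa (expansion t M) < rank (expansion t M))
   <-> (exists2 t : nat, 2 <= t & kappa (expansion t M) < rank (expansion t M)))
  /\ (~ (exists (F1 F2 : {set T}) (e : T),
           [/\ proper_flat M F1, proper_flat M F2
             & F1 :|: F2 :|: [set e] = [set: T]]) ->
      forall t : nat, 1 <= t -> kappa (expansion t M) = rank (expansion t M)).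
Proof.
have H12 : (exists F1 F2 : {set T},
    [/\ proper_flat M F1, proper_flat M F2 & #|~: (F1 :|: F2)| <= 1]) ->
    forall t, 2 <= t -> kappa (expansion t M) < rank (expansion t M).
  move=> [F1 [F2 [p1 p2 c]]] t t2; apply/kappa_ltP.
  exact: (nonspanning_expansion _ _ _ _ t2 p1 p2 c).
have H31 t : kappa (expansion t M) < rank (expansion t M) ->
    exists F1 F2 : {set T},
      [/\ proper_flat M F1, proper_flat M F2 & #|~: (F1 :|: F2)| <= 1].
  by case/kappa_ltP=> X [h1 h2]; apply: (nonspanning_expansion_inv _ _ _ h1 h2).
split; first by split=> // /(_ 2 isT)/H31.
split; first by split=> [/(_ 2 isT)|[t _ /H31/H12]] //; exists 2.
move=> none t _; apply: kappa_eq_rank => X [h1 h2]; apply: none.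
have [F1 [F2 [p1 p2 c]]] := nonspanning_expansion_inv _ _ _ h1 h2.
have [x _ _] : exists2 x, x \in setT & x \notin F1.
  by apply/subsetPn; rewrite subTset; case/andP: p1.
(* If the two flats already cover the ground set, any element serves as [e]; [x] exists because [F1]
   is proper. *)
pose e := odflt x [pick y in ~: (F1 :|: F2)]; exists F1, F2, e; split=> //.
apply/eqP; rewrite -subTset; apply/subsetP => z _.
rewrite in_setU in_set1 -[z \in _]negbK -in_setC -implybE; apply/implyP => zW.
rewrite /e; case: pickP => [y yW|/(_ z)]; last by rewrite zW.
exact/eqP/(card_le1_eqP c).
Qed.
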